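(* Let $X$ be a path-connected space and $x_0\in X$. If $p:\widehat{X}\to X$ is a $\mathbf{Fan}$-covering, $\hat{x}\in p^{-1}(x_0)$, and $H=p_*(\pi_1(\widehat{X},\hat{x}))\subseteq\pi_1(X,x_0)$, then there is a homeomorphism $\hat{p}:\widehat{X}\to\widetilde{X}_H^{qtop}$ such that $p_H\circ\hat{p}=p$.
   Context: Maps are continuous functions. Let $(J,\leq)$ be a directed set and $K=J\cup\{\infty\}$ be obtained by adding one maximal point $\infty$. Give $K$ the topology generated by the basis sets $\{k\}$ and $V_k=\{\infty\}\cup\{j\in J : j>k\}$ for $k\in J$. The directed arc-fan over $J$ is the cone $F(J)=(K\times[0,1])/(K\times\{0\})$ with the quotient topology. $\mathbf{Fan}$ is the full subcategory of the category of path-connected spaces consisting of all path-connected spaces which are a quotient of a topological sum of spaces each of which is either the closed unit disk $D^2$ or a directed arc-fan $F(J)$ for some directed set $J$. A $\mathbf{Fan}$-covering is a map $p:\widehat{X}\to X$ such that $\widehat{X}\in\mathbf{Fan}$ and for every $Y\in\mathbf{Fan}$, $\tilde{x}\in\widehat{X}$, $y\in Y$ and based map $f:(Y,y)\to(X,p(\tilde{x}))$ with $f_*(\pi_1(Y,y))\subseteq p_*(\pi_1(\widehat{X},\tilde{x}))$, there is a unique map $\tilde{f}:(Y,y)\to(\widehat{X},\tilde{x})$ with $p\circ\tilde{f}=f$. $P(X,x_0)$ is the space of paths $\alpha:[0,1]\to X$ with $\alpha(0)=x_0$, with the compact-open topology. For a subgroup $H\subseteq\pi_1(X,x_0)$,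 $\widetilde{X}_H^{qtop}$ is the set of equivalence classes $[\alpha]_H$ of $\alpha\in P(X,x_0)$, where $\alpha\sim\beta$ iff $\alpha(1)=\beta(1)$ and $[\alpha\cdot\beta^-]\in H$ ($\beta^-$ is the reverse path), with the quotient topology with respect to $q:P(X,x_0)\to\widetilde{X}_H^{qtop}$, $q(\alpha)=[\alpha]_H$. The map $p_H:\widetilde{X}_H^{qtop}\to X$ is $p_H([\alpha]_H)=\alpha(1)$. *)

(* Defs.v *)
From HB Require Import structures.
From mathcomp Require Import all_boot all_order all_algebra.
From mathcomp Require Import all_classical all_reals all_analysis.
From mathcomp Require Import generic_quotient homotopy ring lra.

Set Implicit Arguments.
Unset Strict Implicit.
Unset Printing Implicit Defensive.
Import Order.TTheory GRing.Theory Num.Theory.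
Import numFieldNormedType.Exports.
Local Open Scope classical_set_scope.
Local Open Scope ring_scope.
Local Open Scope quotient_scope.

Definition unitI (R : realType) : Type := set_type (`[0%R, 1%R]%classic : set R).

HB.instance Definition _ (R : realType) :=
  Topological.copy (unitI R) (set_type (`[0%R, 1%R]%classic : set R)).

Section UnitInterval.
Context {R : realType}.

Definition ival (s : unitI R) : R := set_val s.

Lemma ival_itv (s : unitI R) : 0 <= ival s <= 1.
Proof. by have := set_valP s; rewrite /= in_itv. Qed.

Lemma clampI_subproof (x : R) :
  Order.max 0 (Order.min x 1) \in (`[0%R, 1%R]%classic : set R).
Proof.
rewrite inE /= in_itv /= le_max lexx /= ge_max ler01 /=.
by rewrite ge_min lexx orbT.
Qed.

(* The retraction of R onto the unit interval. Reparametrized paths are all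
   written a (clampI (f s)), which needs no proof that f s is in [0, 1]. *)
Definition clampI (x : R) : unitI R := exist (fun y => y \in _) _ (clampI_subproof x).

Lemma ival_clampI x : ival (clampI x) = Order.max 0 (Order.min x 1).
Proof. by rewrite /ival set_valE. Qed.

Lemma ival_inj : injective ival.
Proof. by move=> s t; rewrite /ival set_valE => /val_inj. Qed.

Lemma clampI_id x : 0 <= x <= 1 -> ival (clampI x) = x.
Proof. by move=> /andP[x0 x1]; rewrite ival_clampI min_l // max_r. Qed.

Lemma ivalK : cancel ival clampI.
Proof. by move=> s; apply: ival_inj; rewrite clampI_id // ival_itv. Qed.

Lemma unitI_zero_one_neq : clampI 0 != clampI 1.
Proof.
apply/eqP => /(congr1 ival); rewrite !clampI_id ?lexx ?ler01 // => /eqP.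
by rewrite eq_sym oner_eq0.
Qed.

HB.instance Definition _ := isBiPointed.Build (unitI R) unitI_zero_one_neq.

Lemma continuous_ival : continuous ival.
Proof. exact: initial_continuous. Qed.

Lemma continuous_clampI : continuous clampI.
Proof.
apply: (@continuous_comp_initial _ _ _
  (set_val : set_type (`[0%R, 1%R]%classic : set R) -> R) clampI) => x.
have -> : (set_val \o clampI) = ((cst 0 : R -> R) \max (id \min (cst 1))).
  by apply/funext => y; exact: ival_clampI.
apply: continuous_max; first exact: cst_continuous.
by apply: continuous_min; [exact: cvg_id | exact: cst_continuous].
Qed.

Lemma ival0 : ival zero = 0. Proof. by rewrite clampI_id ?lexx ?ler01. Qed.
Lemma ival1 : ival one = 1. Proof. by rewrite clampI_id ?lexx ?ler01. Qed.

Lemma clampI_le0 x : x <= 0 -> clampI x = zero.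
Proof.
move=> x0; apply: ival_inj; rewrite ival0 ival_clampI.
by rewrite min_l ?max_l // (le_trans x0 ler01).
Qed.

Lemma clampI_ge1 x : 1 <= x -> clampI x = one.
Proof.
by move=> x1; apply: ival_inj; rewrite ival1 ival_clampI min_r // max_r.
Qed.

End UnitInterval.

Lemma paste_continuous {R : realType} {T U : topologicalType} (h : T -> R)
    (c : R) (f g : T -> U) :
  continuous h -> continuous f -> continuous g ->
  (forall t, h t = c -> f t = g t) ->
  continuous (fun t => if h t <= c then f t else g t).
Proof.
move=> ch cf cg fg.
pose k t := if h t <= c then f t else g t; rewrite -/k.
pose A := h @^-1` [set y | y <= c]; pose B := h @^-1` [set y | c <= y].
have cA : closed A by apply: closed_comp => [x _|]; [exact: ch|exact: closed_le].
have cB : closed B by apply: closed_comp => [x _|]; [exact: ch|exact: closed_ge].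
have kA : {within A, continuous k}.
  apply: (@subspace_eq_continuous _ A _ f); last exact: continuous_subspaceT.
  by move=> t; rewrite inE => tA; rewrite -[RHS]/(k t) /k ifT.
have kB : {within B, continuous k}.
  apply: (@subspace_eq_continuous _ B _ g); last exact: continuous_subspaceT.
  move=> t; rewrite inE /B /= => ct; rewrite -[RHS]/(k t) /k; case: ifPn => // tc.
  by rewrite fg //; apply: le_anti; rewrite ct tc.
have := withinU_continuous cA cB kA kB.
have -> : A `|` B = setT.
  by rewrite -subTset => t _; case: (leP (h t) c) => [|/ltW]; [left|right].
by move=> kT; exact/continuous_subspace_setT.
Qed.

Lemma continuous_compT {T U V : topologicalType} (f : T -> U) (g : U -> V) :
  continuous f -> continuous g -> continuous (fun t => g (f t)).
Proof. by move=> cf cg t; apply: (continuous_comp (cf t) (cg _)). Qed.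

Lemma continuous_pairT {T U V : topologicalType} (f : T -> U) (g : T -> V) :
  continuous f -> continuous g -> continuous (fun t => (f t, g t)).
Proof. by move=> cf cg t; apply: cvg_pair; [exact: cf|exact: cg]. Qed.

Lemma continuous_fstT {T U : topologicalType} : continuous (@fst T U).
Proof. by move=> t; exact: cvg_fst. Qed.

Lemma continuous_sndT {T U : topologicalType} : continuous (@snd T U).
Proof. by move=> t; exact: cvg_snd. Qed.

Lemma continuous_addT {R : realType} {T : topologicalType} (f g : T -> R) :
  continuous f -> continuous g -> continuous (fun t => f t + g t).
Proof. by move=> cf cg t; apply: cvgD; [exact: cf|exact: cg]. Qed.

Lemma continuous_oppT {R : realType} {T : topologicalType} (f : T -> R) :
  continuous f -> continuous (fun t => - f t).
Proof. by move=> cf t; apply: cvgN; exact: cf. Qed.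

Lemma continuous_mulT {R : realType} {T : topologicalType} (f g : T -> R) :
  continuous f -> continuous g -> continuous (fun t => f t * g t).
Proof. by move=> cf cg t; apply: cvgM; [exact: cf|exact: cg]. Qed.

Lemma continuous_minT {R : realType} {T : topologicalType} (f g : T -> R) :
  continuous f -> continuous g -> continuous (fun t => Order.min (f t) (g t)).
Proof. by move=> cf cg t; apply: continuous_min; [exact: cf|exact: cg]. Qed.

Lemma continuous_cstT {T U : topologicalType} (u : U) :
  continuous (fun _ : T => u).
Proof. by move=> t; exact: cvg_cst. Qed.

Lemma continuous_clampT {R : realType} {T : topologicalType} (f : T -> R) :
  continuous f -> continuous (fun t => clampI (f t)).
Proof. by move=> cf; apply: continuous_compT cf _; exact: continuous_clampI. Qed.

Local Ltac cts :=
  repeat first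
    [ apply: continuous_clampT
    | apply: continuous_pairT
    | apply: continuous_minT
    | apply: continuous_addT
    | apply: continuous_oppT
    | apply: continuous_mulT
    | exact: continuous_ival
    | exact: continuous_fstT
    | exact: continuous_sndT
    | exact: continuous_cstT
    | exact: (continuous_compT continuous_fstT continuous_ival)
    | exact: (continuous_compT continuous_sndT continuous_ival)].

Section Paths.
Context {R : realType} {X : topologicalType}.
Local Notation I := (unitI R).
Local Notation "x ~> y" := ({path I from x to y}) (at level 70).
Implicit Types x y z : X.

Section Cat.
Context {x y z : X} (a : x ~> y) (b : y ~> z).

Definition cat_fun (s : I) : X :=
  if ival s <= 2^-1 then a (clampI (2 * ival s))
  else b (clampI (2 * ival s - 1)).

Lemma continuous_cat_fun : continuous cat_fun.
Proof.
apply: (paste_continuous (h := ival)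
  (f := fun s => a (clampI (2 * ival s)))
  (g := fun s => b (clampI (2 * ival s - 1)))); first exact: continuous_ival.
- by apply: (continuous_compT _ (@cts_fun _ _ a)); cts.
- by apply: (continuous_compT _ (@cts_fun _ _ b)); cts.
- move=> s ->; rewrite divff ?subrr ?pnatr_eq0 // .
  by rewrite clampI_ge1 // clampI_le0 // path_zero path_one.
Qed.

Lemma cat_fun_zero : cat_fun zero = x.
Proof.
by rewrite /cat_fun ival0 invr_ge0 ler0n mulr0 clampI_le0 // path_zero.
Qed.

Lemma cat_fun_one : cat_fun one = z.
Proof.
rewrite /cat_fun ival1 ifF; last by lra.
by rewrite clampI_ge1 ?path_one //; lra.
Qed.

Definition path_cat : x ~> z :=
  mk_path continuous_cat_fun cat_fun_zero cat_fun_one.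
End Cat.

Section Rev.
Context {x y : X} (a : x ~> y).

Definition rev_fun (s : I) : X := a (clampI (1 - ival s)).

Lemma continuous_rev_fun : continuous rev_fun.
Proof. by apply: (continuous_compT _ (@cts_fun _ _ a)); cts. Qed.

Lemma rev_fun_zero : rev_fun zero = y.
Proof. by rewrite /rev_fun ival0 subr0 clampI_ge1 // path_one. Qed.

Lemma rev_fun_one : rev_fun one = x.
Proof. by rewrite /rev_fun ival1 subrr clampI_le0 // path_zero. Qed.

Definition path_rev : y ~> x :=
  mk_path continuous_rev_fun rev_fun_zero rev_fun_one.
End Rev.

Definition path_cst x : x ~> x := cst x.

(* Homotopy relative to the endpoints; the second coordinate of I * I is the
   time of the homotopy. *)
Definition path_homotopic x y (a b : x ~> y) : Prop :=
  exists F : I * I -> X,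
    [/\ continuous F,
        forall s, F (s, zero) = a s, forall s, F (s, one) = b s,
        forall t, F (zero, t) = x & forall t, F (one, t) = y].

Lemma path_homotopic_refl x y (a : x ~> y) : path_homotopic a a.
Proof.
exists (fun st => a st.1); split=> //= [|_|_]; last 2 first.
- exact: path_zero.
- exact: path_one.
by apply: (continuous_compT _ (@cts_fun _ _ a)); cts.
Qed.

Lemma path_homotopic_sym x y (a b : x ~> y) :
  path_homotopic a b -> path_homotopic b a.
Proof.
move=> [F [cF Fa Fb F0 F1]].
exists (fun st => F (st.1, clampI (1 - ival st.2))); split=> //= [|s|s].
- by apply: continuous_compT cF; cts.
- by rewrite ival0 subr0 clampI_ge1.
- by rewrite ival1 subrr clampI_le0.
Qed.

Lemma path_homotopic_trans x y (a b c : x ~> y) :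
  path_homotopic a b -> path_homotopic b c -> path_homotopic a c.
Proof.
move=> [F [cF Fa Fb F0 F1]] [G [cG Gb Gc G0 G1]].
exists (fun st => if ival st.2 <= 2^-1 then F (st.1, clampI (2 * ival st.2))
                  else G (st.1, clampI (2 * ival st.2 - 1))).
split=> [|s|s|t|t] /=.
- apply: (paste_continuous (h := fun st : I * I => ival st.2)
    (f := fun st => F (st.1, clampI (2 * ival st.2)))
    (g := fun st => G (st.1, clampI (2 * ival st.2 - 1)))).
  + by cts.
  + by apply: continuous_compT cF; cts.
  + by apply: continuous_compT cG; cts.
  + move=> [s t] /= ->; rewrite divff ?subrr ?pnatr_eq0 //.
    by rewrite clampI_ge1 // clampI_le0 // Fb Gb.
- by rewrite ival0 invr_ge0 ler0n mulr0 clampI_le0 // Fa.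
- rewrite ival1 ifF; last by lra.
  by rewrite clampI_ge1 ?Gc //; lra.
- by case: ifP.
- by case: ifP.
Qed.

Lemma path_homotopic_reparam x y x' y' (a : x ~> y) (p q : x' ~> y')
    (f g : I -> R) :
  continuous f -> continuous g -> f zero = g zero -> f one = g one ->
  (forall s, p s = a (clampI (f s))) -> (forall s, q s = a (clampI (g s))) ->
  path_homotopic p q.
Proof.
move=> cf cg fg0 fg1 pE qE.
pose h (st : I * I) := f st.1 + ival st.2 * (g st.1 - f st.1).
exists (fun st => a (clampI (h st))); rewrite /h; split=> [|s|s|t|t] /=.
- apply: (continuous_compT _ (@cts_fun _ _ a)).
  have cf1 := continuous_compT (@continuous_fstT I I) cf.
  have cg1 := continuous_compT (@continuous_fstT I I) cg.
  by cts.
- by rewrite ival0 mul0r addr0 pE.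
- by rewrite ival1 mul1r addrC subrK qE.
- by rewrite fg0 subrr mulr0 addr0 -qE path_zero.
- by rewrite fg1 subrr mulr0 addr0 -qE path_one.
Qed.

Lemma path_homotopic_cat x y z (a a' : x ~> y) (b b' : y ~> z) :
  path_homotopic a a' -> path_homotopic b b' ->
  path_homotopic (path_cat a b) (path_cat a' b').
Proof.
move=> [F [cF Fa Fa' F0 F1]] [G [cG Gb Gb' G0 G1]].
exists (fun st => if ival st.1 <= 2^-1 then F (clampI (2 * ival st.1), st.2)
                  else G (clampI (2 * ival st.1 - 1), st.2)).
split=> [|s|s|t|t] /=.
- apply: (paste_continuous (h := fun st : I * I => ival st.1)
    (f := fun st => F (clampI (2 * ival st.1), st.2))
    (g := fun st => G (clampI (2 * ival st.1 - 1), st.2))).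
  + by cts.
  + by apply: continuous_compT cF; cts.
  + by apply: continuous_compT cG; cts.
  + move=> [s t] /= ->; rewrite divff ?subrr ?pnatr_eq0 //.
    by rewrite clampI_ge1 // clampI_le0 // F1 G0.
- by rewrite Fa Gb.
- by rewrite Fa' Gb'.
- by rewrite ival0 invr_ge0 ler0n mulr0 clampI_le0.
- rewrite ival1 ifF; last by lra.
  by rewrite clampI_ge1 ?G1 //; lra.
Qed.

Lemma path_homotopic_rev x y (a b : x ~> y) :
  path_homotopic a b -> path_homotopic (path_rev a) (path_rev b).
Proof.
move=> [F [cF Fa Fb F0 F1]].
exists (fun st => F (clampI (1 - ival st.1), st.2)); split=> //= [|s|s|t|t].
- by apply: continuous_compT cF; cts.
- by rewrite Fa.
- by rewrite Fb.
- by rewrite ival0 subr0 clampI_ge1.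
- by rewrite ival1 subrr clampI_le0.
Qed.

Lemma cat_funL x y z (a : x ~> y) (b : y ~> z) (r : R) :
  0 <= r <= 2^-1 -> path_cat a b (clampI r) = a (clampI (2 * r)).
Proof.
move=> /andP[r0 r1]; rewrite -[LHS]/(cat_fun a b (clampI r)) /cat_fun clampI_id.
  by rewrite r1.
by rewrite r0 /=; lra.
Qed.

Lemma cat_funR x y z (a : x ~> y) (b : y ~> z) (r : R) :
  2^-1 < r <= 1 -> path_cat a b (clampI r) = b (clampI (2 * r - 1)).
Proof.
move=> /andP[r0 r1]; rewrite -[LHS]/(cat_fun a b (clampI r)) /cat_fun clampI_id.
  by rewrite leNgt r0.
by rewrite r1 andbT; lra.
Qed.

Lemma path_homotopic_catA x y z w (a : x ~> y) (b : y ~> z) (c : z ~> w) :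
  path_homotopic (path_cat a (path_cat b c)) (path_cat (path_cat a b) c).
Proof.
apply: path_homotopic_sym.
pose f (r : R) := Order.min (2 * r) (Order.min (r + 4^-1) ((r + 1) / 2)).
apply: (@path_homotopic_reparam _ _ _ _ (path_cat a (path_cat b c)) _ _
  (fun s => f (ival s)) ival).
- by rewrite /f; cts.
- exact: continuous_ival.
- by rewrite ival0 /f /Order.min; do 2 case: ifP; lra.
- by rewrite ival1 /f /Order.min; do 2 case: ifP; lra.
- move=> s; rewrite -{1}[s]ivalK; have /andP[s0 s1] := ival_itv s.
  move: (ival s) s0 s1 => r r0 r1; have [r2|r2] := leP r 2^-1.
    rewrite (cat_funL (path_cat a b)) ?r0 ?r2 //.
    have [r4|r4] := leP (2 * r) 2^-1.
      have -> : f r = 2 * r by rewrite /f /Order.min; do 2 case: ifP; lra.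
      by rewrite !cat_funL //; lra.
    have -> : f r = r + 4^-1 by rewrite /f /Order.min; do 2 case: ifP; lra.
    rewrite (cat_funR a b) ?(cat_funR a) ?cat_funL; [|lra..].
    by congr (b (clampI _)); lra.
  have -> : f r = (r + 1) / 2 by rewrite /f /Order.min; do 2 case: ifP; lra.
  rewrite (cat_funR (path_cat a b)) ?(cat_funR a) ?cat_funR; [|lra..].
  by congr (c (clampI _)); lra.
- by move=> s; rewrite ivalK.
Qed.

Lemma path_homotopic_1cat x y (a : x ~> y) :
  path_homotopic (path_cat (path_cst x) a) a.
Proof.
pose f (s : I) := clampI (2 * ival s - 1).
have cf : continuous f by rewrite /f; cts.
apply: (@path_homotopic_reparam _ _ _ _ a _ _ (fun s => ival (f s)) ival).
- exact: (continuous_compT cf continuous_ival).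
- exact: continuous_ival.
- by rewrite /f ival0 clampI_le0 ?ival0 //; lra.
- by rewrite /f ival1 clampI_ge1 ?ival1 //; lra.
- move=> s; rewrite ivalK /f -{1}[s]ivalK; have /andP[s0 s1] := ival_itv s.
  move: (ival s) s0 s1 => r r0 r1; have [r2|r2] := leP r 2^-1.
    by rewrite cat_funL ?r0 // (clampI_le0 (x := 2 * r - 1)) ?path_zero //; lra.
  by rewrite cat_funR ?r1 ?r2.
- by move=> s; rewrite ivalK.
Qed.

Lemma path_homotopic_cat1 x y (a : x ~> y) :
  path_homotopic (path_cat a (path_cst y)) a.
Proof.
pose f (s : I) := clampI (2 * ival s).
have cf : continuous f by rewrite /f; cts.
apply: (@path_homotopic_reparam _ _ _ _ a _ _ (fun s => ival (f s)) ival).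
- exact: (continuous_compT cf continuous_ival).
- exact: continuous_ival.
- by rewrite /f ival0 clampI_le0 ?ival0 //; lra.
- by rewrite /f ival1 clampI_ge1 ?ival1 //; lra.
- move=> s; rewrite ivalK /f -{1}[s]ivalK; have /andP[s0 s1] := ival_itv s.
  move: (ival s) s0 s1 => r r0 r1; have [r2|r2] := leP r 2^-1.
    by rewrite cat_funL ?r0.
  by rewrite cat_funR ?r1 ?r2 // (clampI_ge1 (x := 2 * r)) ?path_one //; lra.
- by move=> s; rewrite ivalK.
Qed.

Lemma path_homotopic_catV x y (a : x ~> y) :
  path_homotopic (path_cat a (path_rev a)) (path_cst x).
Proof.
pose f (r : R) := Order.min (2 * r) (2 - 2 * r).
apply: (@path_homotopic_reparam _ _ _ _ a _ _ (fun s => f (ival s)) (fun=> 0)).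
- by rewrite /f; cts.
- exact: continuous_cstT.
- by rewrite ival0 /f /Order.min; case: ifP; lra.
- by rewrite ival1 /f /Order.min /=; case: ifP; lra.
- move=> s; rewrite -{1}[s]ivalK; have /andP[s0 s1] := ival_itv s.
  move: (ival s) s0 s1 => r r0 r1; have [r2|r2] := leP r 2^-1.
    rewrite cat_funL ?r0 ?r2 //; congr (a (clampI _)).
    by rewrite /f /Order.min; case: ifP; lra.
  rewrite cat_funR ?r1 ?r2 //; rewrite -[LHS]/(a (clampI (1 - ival (clampI (2 * r - 1))))).
  rewrite clampI_id; last by lra.
  by congr (a (clampI _)); rewrite /f /Order.min; case: ifP; lra.
- by move=> s; rewrite clampI_le0 // path_zero.
Qed.

Lemma path_revK x y (a : x ~> y) : path_rev (path_rev a) = a.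
Proof.
apply/path_eqP => s; rewrite -[LHS]/(a (clampI (1 - ival (clampI (1 - ival s))))).
have /andP[s0 s1] := ival_itv s.
by rewrite clampI_id ?subKr ?ivalK //; lra.
Qed.

Lemma path_rev_cat x y z (a : x ~> y) (b : y ~> z) :
  path_rev (path_cat a b) = path_cat (path_rev b) (path_rev a).
Proof.
apply/path_eqP => s; rewrite -[LHS]/(path_cat a b (clampI (1 - ival s))).
rewrite -[in RHS](ivalK s); have /andP[] := ival_itv s.
move: (ival s) => r r0 r1; have [r2|r2|r2] := ltgtP r 2^-1.
- rewrite (cat_funR a b) ?(cat_funL (path_rev b)); [|lra..].
  rewrite -[RHS]/(b (clampI (1 - ival (clampI (2 * r))))) clampI_id; last lra.
  by congr (b (clampI _)); lra.
- rewrite (cat_funL a b) ?(cat_funR (path_rev b)); [|lra..].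
  rewrite -[RHS]/(a (clampI (1 - ival (clampI (2 * r - 1))))) clampI_id; last lra.
  by congr (a (clampI _)); lra.
- rewrite !cat_funL; [|lra..]; rewrite r2.
  rewrite !clampI_ge1; [|lra..]; rewrite !path_one //.
Qed.

Lemma path_equiv_refl x y :
  reflexive (fun a b : x ~> y => `[< path_homotopic a b >]).
Proof. by move=> a; apply/asboolP; exact: path_homotopic_refl. Qed.

Lemma path_equiv_sym x y :
  symmetric (fun a b : x ~> y => `[< path_homotopic a b >]).
Proof. by move=> a b; apply/asboolP/asboolP; exact: path_homotopic_sym. Qed.

Lemma path_equiv_trans x y :
  transitive (fun a b : x ~> y => `[< path_homotopic a b >]).
Proof.
move=> b a c /asboolP ab /asboolP bc; apply/asboolP.
exact: path_homotopic_trans ab bc.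
Qed.

Definition path_equiv x y : equiv_rel (x ~> y) :=
  EquivRel _ (@path_equiv_refl x y) (@path_equiv_sym x y)
    (@path_equiv_trans x y).

(* The hom-sets of the fundamental groupoid, composed in path order: the
   product of the classes of a and b is the class of a followed by b. *)
Definition path_class x y : Type := {eq_quot (path_equiv x y)}.

HB.instance Definition _ x y := Choice.on (path_class x y).
HB.instance Definition _ x y := EqQuotient.on (path_class x y).

Definition pclass x y (a : x ~> y) : path_class x y :=
  \pi_(path_class x y) a.

Lemma pclassP x y (a b : x ~> y) : pclass a = pclass b <-> path_homotopic a b.
Proof.
split=> [/eqmodP/asboolP //|ab]; apply/eqmodP.
exact/asboolP.
Qed.

Lemma pclass_ind x y (P : path_class x y -> Prop) :
  (forall a, P (pclass a)) -> forall u, P u.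
Proof. by move=> Pa u; rewrite -[u]reprK; exact: Pa. Qed.

Definition pc_mul x y z (u : path_class x y) (v : path_class y z) :
  path_class x z := pclass (path_cat (repr u) (repr v)).

Definition pc_inv x y (u : path_class x y) : path_class y x :=
  pclass (path_rev (repr u)).

Definition pc_one x : path_class x x := pclass (path_cst x).

Lemma repr_pclass x y (a : x ~> y) : path_homotopic (repr (pclass a)) a.
Proof. by apply/pclassP; rewrite /pclass reprK. Qed.

Lemma pc_mulE x y z (a : x ~> y) (b : y ~> z) :
  pc_mul (pclass a) (pclass b) = pclass (path_cat a b).
Proof. by apply/pclassP/path_homotopic_cat; exact: repr_pclass. Qed.

Lemma pc_invE x y (a : x ~> y) : pc_inv (pclass a) = pclass (path_rev a).
Proof. by apply/pclassP/path_homotopic_rev; exact: repr_pclass. Qed.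

Lemma pc_mulA x y z w (u : path_class x y) (v : path_class y z)
    (t : path_class z w) :
  pc_mul u (pc_mul v t) = pc_mul (pc_mul u v) t.
Proof.
move: u v t; do 3 apply: pclass_ind => ?; rewrite !pc_mulE.
exact/pclassP/path_homotopic_catA.
Qed.

Lemma pc_mul1 x y (u : path_class x y) : pc_mul (pc_one x) u = u.
Proof.
move: u; apply: pclass_ind => a; rewrite pc_mulE.
exact/pclassP/path_homotopic_1cat.
Qed.

Lemma pc_mulr1 x y (u : path_class x y) : pc_mul u (pc_one y) = u.
Proof.
move: u; apply: pclass_ind => a; rewrite pc_mulE.
exact/pclassP/path_homotopic_cat1.
Qed.

Lemma pc_mulV x y (u : path_class x y) : pc_mul u (pc_inv u) = pc_one x.
Proof.
move: u; apply: pclass_ind => a; rewrite pc_invE pc_mulE.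
exact/pclassP/path_homotopic_catV.
Qed.

Lemma pc_invK x y (u : path_class x y) : pc_inv (pc_inv u) = u.
Proof. by move: u; apply: pclass_ind => a; rewrite !pc_invE path_revK. Qed.

Lemma pc_mulVr x y (u : path_class x y) : pc_mul (pc_inv u) u = pc_one y.
Proof. by rewrite -{2}[u]pc_invK pc_mulV. Qed.

Definition pi1 x : Type := path_class x x.

HB.instance Definition _ x := Choice.on (pi1 x).
HB.instance Definition _ x := @isGroup.Build (pi1 x)
  (pc_one x) (@pc_inv x x) (@pc_mul x x x)
  (fun u v t => @pc_mulA x x x x u v t) (fun u => @pc_mul1 x x u)
  (fun u => @pc_mulr1 x x u) (fun u => @pc_mulVr x x u)
  (fun u => @pc_mulV x x u).

End Paths.

Arguments pi1 R {X} x.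

Section InducedMap.
Context {R : realType} {X Y : topologicalType} (f : continuousType X Y).
Local Notation I := (unitI R).

Section PathMap.
Context {x x' : X} {y y' : Y} (e : f x = y) (e' : f x' = y').
Context (a : {path I from x to x'}).

Lemma path_map_zero : f (a zero) = y. Proof. by rewrite path_zero. Qed.
Lemma path_map_one : f (a one) = y'. Proof. by rewrite path_one. Qed.

Definition path_map : {path I from y to y'} :=
  mk_path (continuous_compT (@cts_fun _ _ a) (@cts_fun _ _ f))
    path_map_zero path_map_one.
End PathMap.

Lemma path_homotopic_map (x x' : X) (y y' : Y) (e : f x = y) (e' : f x' = y')
    (a b : {path I from x to x'}) :
  path_homotopic a b -> path_homotopic (path_map e e' a) (path_map e e' b).
Proof.
move=> [F [cF Fa Fb F0 F1]]; exists (fun st => f (F st)).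
split=> [|s|s|t|t]; rewrite ?Fa ?Fb ?F0 ?F1 //.
exact: (continuous_compT cF (@cts_fun _ _ f)).
Qed.

Context {x : X} {y : Y} (e : f x = y).

(* The base points are related by the equation e rather than by conversion, so
   that a map sending x to y induces a morphism into pi1 at y itself. *)
Definition pi1_map (u : pi1 R x) : pi1 R y := pclass (path_map e e (repr u)).

Lemma pi1_mapE (a : {path I from x to x}) :
  pi1_map (pclass a) = pclass (path_map e e a).
Proof. by apply/pclassP/path_homotopic_map; exact: repr_pclass. Qed.

Lemma pi1_map_monoid_morphism : monoid.monoid_morphism pi1_map.
Proof.
split.
  rewrite -[1%g]/(pclass (path_cst x)) pi1_mapE.
  by congr pclass; apply/path_eqP => s; exact: e.
apply: pclass_ind => a; apply: pclass_ind => b.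
rewrite -[(_ * _)%g in LHS]/(pc_mul (pclass a) (pclass b)).
rewrite pc_mulE !pi1_mapE -[RHS]/(pc_mul _ _) pc_mulE.
congr pclass; apply/path_eqP => s.
rewrite -[LHS]/(f (cat_fun a b s)) -[RHS]/(cat_fun _ _ s) /cat_fun.
by case: ifP.
Qed.

HB.instance Definition _ :=
  monoid.isUMagmaMorphism.Build (pi1 R x) (pi1 R y) pi1_map pi1_map_monoid_morphism.

Definition pi1_image : {pred pi1 R y} :=
  fun v => `[< exists u, pi1_map u = v >].

Lemma pi1_imageP (v : pi1 R y) : v \in pi1_image <-> exists u, pi1_map u = v.
Proof. by split=> [/asboolP|?] //; exact/asboolP. Qed.

Lemma pi1_image_mul : mulg_closed pi1_image.
Proof.
move=> _ _ /pi1_imageP[u <-] /pi1_imageP[v <-]; apply/pi1_imageP.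
by exists (u * v)%g; rewrite gmulfM.
Qed.

Lemma pi1_image_one : (1%g : pi1 R y) \in pi1_image.
Proof. by apply/pi1_imageP; exists 1%g; rewrite gmulf1. Qed.

Lemma pi1_image_inv : invg_closed pi1_image.
Proof.
move=> _ /pi1_imageP[u <-]; apply/pi1_imageP.
by exists (u^-1)%g; rewrite gmulfV.
Qed.

HB.instance Definition _ := isMulClosed.Build _ pi1_image pi1_image_mul.
HB.instance Definition _ := isMul1Closed.Build _ pi1_image pi1_image_one.
HB.instance Definition _ := isInvClosed.Build _ pi1_image pi1_image_inv.

End InducedMap.

Section PathSpace.
Context {R : realType} {X : topologicalType}.
Local Notation I := (unitI R).

(* Subspace of the compact-open topology on all functions. *)
Definition path_space (x0 : X) : Type :=
  set_type [set a : {compact-open, I -> X} |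
              continuous (a : I -> X) /\ (a : I -> X) zero = x0].

HB.instance Definition _ (x0 : X) := Topological.copy (path_space x0)
  (set_type [set a : {compact-open, I -> X} |
              continuous (a : I -> X) /\ (a : I -> X) zero = x0]).

Context {x0 : X}.

Definition psval (a : path_space x0) : I -> X := set_val a.

Lemma psvalP (a : path_space x0) : continuous (psval a) /\ psval a zero = x0.
Proof. exact: (set_valP a). Qed.

Definition path_to (a : path_space x0) (y : X) (e : psval a one = y) :
    {path I from x0 to y} :=
  mk_path (psvalP a).1 (psvalP a).2 e.

Section ModSubgroup.
Variable H : groupClosed (pi1 R x0).

Definition path_mod (a b : path_space x0) : Prop :=
  exists e : psval a one = psval b one,
    (pclass (path_cat (path_to e) (path_rev (path_to (erefl (psval b one)))))
       : pi1 R x0) \in H.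

Lemma path_modP (a b : path_space x0) :
  path_mod a b <->
  exists y (ea : psval a one = y) (eb : psval b one = y),
    (pc_mul (pclass (path_to ea)) (pc_inv (pclass (path_to eb))) : pi1 R x0)
      \in H.
Proof.
split=> [[e abH]|[y [ea [eb]]]].
  by exists (psval b one), e, erefl; rewrite pc_invE pc_mulE.
by move: ea; case: _ / eb => ea; rewrite pc_invE pc_mulE; exists ea.
Qed.

Lemma path_mod_refl : reflexive (fun a b => `[< path_mod a b >]).
Proof.
move=> a; apply/asboolP/path_modP.
by exists (psval a one), erefl, erefl; rewrite pc_mulV; exact: gpred1.
Qed.

Lemma path_mod_symP (a b : path_space x0) : path_mod a b -> path_mod b a.
Proof.
move=> /path_modP[y [ea [eb abH]]]; apply/path_modP; exists y, eb, ea.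
have := gpredVr _ abH; congr (_ \in H).
rewrite -[LHS]/(pc_inv _).
move: (pclass (path_to ea)) (pclass (path_to eb)).
do 2 apply: pclass_ind => ?.
by rewrite !(pc_invE, pc_mulE) path_rev_cat path_revK.
Qed.

Lemma path_mod_sym : symmetric (fun a b => `[< path_mod a b >]).
Proof. by move=> a b; apply/asboolP/asboolP; exact: path_mod_symP. Qed.

Lemma path_mod_trans : transitive (fun a b => `[< path_mod a b >]).
Proof.
move=> b a c /asboolP/path_modP[y [ea [eb abH]]].
move=> /asboolP/path_modP[z [eb' [ec bcH]]]; apply/asboolP/path_modP.
have yz : y = z by rewrite -eb.
move: eb' ec bcH; case: _ / yz => eb' ec bcH.
exists y, ea, ec; have := gpredM _ _ abH bcH; congr (_ \in H).
rewrite -[LHS]/(pc_mul _ _) (Prop_irrelevance eb' eb).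
by rewrite pc_mulA -(pc_mulA _ (pc_inv _)) pc_mulVr pc_mulr1.
Qed.

Definition path_mod_equiv : equiv_rel (path_space x0) :=
  EquivRel _ path_mod_refl path_mod_sym path_mod_trans.

Definition qtop_space : Type := {eq_quot path_mod_equiv}.

HB.instance Definition _ :=
  Topological.copy qtop_space (quotient_topology {eq_quot path_mod_equiv}).
HB.instance Definition _ := EqQuotient.on qtop_space.

(* The projection to X; endpointE shows that it does not depend on repr. *)
Definition endpoint (u : qtop_space) : X := psval (repr u) one.

Lemma endpointE (a : path_space x0) :
  endpoint (\pi_qtop_space a) = psval a one.
Proof.
suff /asboolP[e _] : path_mod_equiv (repr (\pi_qtop_space a)) a by [].
by apply/eqmodP; rewrite reprK.
Qed.
End ModSubgroup.
End PathSpace.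

Arguments path_space R {X} x0.

(* Directed sets are nonempty preorders with upper bounds of pairs;
   antisymmetry is not required, and k < j means that k <= j and not j <= k. *)
Record directedType := DirectedType {
  dir_disp : Order.disp_t;
  dir_sort :> preorderType dir_disp;
  dir_inhab : inhabited dir_sort;
  dir_upper : forall i j : dir_sort, exists2 k : dir_sort,
    (i <= k)%O & (j <= k)%O }.

Section DirectedSpace.
Variable J : directedType.

(* The point None is the added maximal point. *)
Definition dir_space : Type := option J.

HB.instance Definition _ := Choice.on dir_space.

Definition dir_tail (k : J) : set dir_space :=
  [set None] `|` [set Some j | j in [set j : J | (k < j)%O]].

Definition dir_base : set (set dir_space) :=
  [set [set Some k] | k in [set: J]] `|` range dir_tail.

Lemma dir_base_cover : \bigcup_(V in dir_base) id V = [set: dir_space].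
Proof.
rewrite -subTset => -[j|] _; first by exists [set Some j] => //; left; exists j.
have [k] := dir_inhab J; exists (dir_tail k); last by left.
by right; exists k.
Qed.

Lemma dir_base_join (U V : set dir_space) (t : dir_space) :
  dir_base U -> dir_base V -> id U t -> id V t ->
  exists W, [/\ dir_base W, id W t & id W `<=` id U `&` id V].
Proof.
case: t => [j|] bU bV Ut Vt.
  by exists [set Some j]; split; [left; exists j| |move=> _ ->].
case: bU Ut => [[k _ <-]//|[k _ <-] _]; case: bV Vt => [[l _ <-]//|[l _ <-] _].
have [m km lm] := dir_upper k l; exists (dir_tail m).
split; [by right; exists m|by left|].
move=> _ [->|[j mj <-]]; first by split; left.
by split; right; exists j => //=; apply: le_lt_trans mj.
Qed.

HB.instance Definition _ :=
  isBaseTopological.Build dir_space dir_base_cover dir_base_join.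

End DirectedSpace.

Section Fans.
Variable R : realType.
Local Notation I := (unitI R).

Section ArcFan.
Variable J : directedType.

(* Collapses dir_space J * {0} to a point. *)
Definition cone_base (a b : dir_space J * I) : bool :=
  (a == b) || ((a.2 == zero) && (b.2 == zero)).

Lemma cone_base_refl : reflexive cone_base.
Proof. by move=> a; rewrite /cone_base eqxx. Qed.

Lemma cone_base_sym : symmetric cone_base.
Proof. by move=> a b; rewrite /cone_base eq_sym andbC. Qed.

Lemma cone_base_trans : transitive cone_base.
Proof.
move=> b a c /predU1P[-> //|/andP[a0 b0]] /predU1P[<-|/andP[_ c0]].
  by rewrite /cone_base a0 b0 orbT.
by rewrite /cone_base a0 c0 orbT.
Qed.

Definition cone_equiv : equiv_rel (dir_space J * I) :=
  EquivRel _ cone_base_refl cone_base_sym cone_base_trans.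

Definition arc_fan : Type := {eq_quot cone_equiv}.

HB.instance Definition _ :=
  Topological.copy arc_fan (quotient_topology {eq_quot cone_equiv}).
End ArcFan.

Definition unit_disk : Type :=
  set_type [set z : R * R | z.1 ^+ 2 + z.2 ^+ 2 <= 1].

HB.instance Definition _ := Topological.copy unit_disk
  (set_type [set z : R * R | z.1 ^+ 2 + z.2 ^+ 2 <= 1]).

(* None codes the disk, Some J the arc-fan over J. *)
Definition fan_piece (o : option directedType) : topologicalType :=
  if o is Some J then arc_fan J else unit_disk.

Definition path_connected (X : topologicalType) : Prop :=
  forall x y : X, inhabited {path I from x to y}.

Definition quotient_map (S Y : topologicalType) (q : S -> Y) : Prop :=
  range q = [set: Y] /\ forall U : set Y, open U <-> open (q @^-1` U).

Definition in_Fan (Y : topologicalType) : Prop :=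
  path_connected Y /\
  exists (A : choiceType) (o : A -> option directedType)
    (q : {a : A & fan_piece (o a)} -> Y), quotient_map q.

Definition Fan_covering (Xh X : topologicalType) (p : continuousType Xh X) :
    Prop :=
  in_Fan Xh /\
  forall (Y : topologicalType) (xt : Xh) (y : Y) (f : continuousType Y X)
    (fy : f y = p xt),
    in_Fan Y ->
    {subset pi1_image (R := R) fy <= pi1_image (R := R) (erefl (p xt))} ->
    exists! g : continuousType Y Xh, g y = xt /\ p \o g = f.
End Fans.

Definition homeomorphism (S T : topologicalType) (f : S -> T) : Prop :=
  continuous f /\
  exists g : T -> S, [/\ continuous g, cancel f g & cancel g f].

(* Main.v *)
(* The candidate inverse sends the class of a path in X to the endpoint of its
   lift.  It is continuous because continuity on any space is detected by maps
   from the spaces K of directed sets: K -> P(X, x0) is the same as a map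
   K * [0, 1] -> X constant on K * {0}, that is a map F(J) -> X, which lifts as
   a whole; by uniqueness its lift restricts on each arc to the lift of the
   corresponding path.  Conversely the bijection itself is continuous because
   its source is a quotient of disks and arc-fans, which are cones: joining the
   vertex to each point depends continuously on the point, so that locally the
   bijection factors through the path space. *)
Require Import Defs.
From HB Require Import structures.
From mathcomp Require Import all_boot all_order all_algebra.
From mathcomp Require Import all_classical all_reals all_analysis.
From mathcomp Require Import homotopy.
From mathcomp Require Import generic_quotient lra.

Set Implicit Arguments.
Unset Strict Implicit.
Unset Printing Implicit Defensive.

Import Order.TTheory GRing.Theory Num.Theory.
Import numFieldNormedType.Exports.
Local Open Scope classical_set_scope.
Local Open Scope ring_scope.
Local Open Scope quotient_scope.

(** * Slices of maps on products, and the exponential law over the unit interval *)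

Lemma continuous_slicel {T U V : topologicalType} (F : T * U -> V) (u : U) :
  continuous F -> continuous (fun t => F (t, u)).
Proof.
move=> cF; apply: continuous_compT cF; apply: continuous_pairT => [t|].
  exact: cvg_id.
exact: continuous_cstT.
Qed.

Lemma continuous_slicer {T U V : topologicalType} (F : T * U -> V) (t : T) :
  continuous F -> continuous (fun u => F (t, u)).
Proof.
move=> cF; apply: continuous_compT cF; apply: continuous_pairT => [|u].
  exact: continuous_cstT.
exact: cvg_id.
Qed.

Section UnitIntervalTopology.
Variable R : realType.
Local Notation I := (unitI R).

Lemma unitI_hausdorff : hausdorff_space I.
Proof.
move=> s t st; apply: ival_inj; apply: (@Rhausdorff R) => A B As Bt.
have [u [Au Bu]] := st _ _ (continuous_ival As) (continuous_ival Bt).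
by exists (ival u).
Qed.

Lemma unitI_compact : compact [set: I].
Proof.
rewrite -(_ : clampI @` `[0%R, 1%R]%classic = [set: I]); last first.
  rewrite -subTset => s _; exists (ival s); last exact: ivalK.
  by rewrite /= in_itv /= ival_itv.
apply: continuous_compact; last exact: segment_compact.
exact/continuous_subspaceT/continuous_clampI.
Qed.

Lemma unitI_locally_compact : locally_compact [set: I].
Proof.
move=> s _; rewrite withinET; exists [set: I]; first exact: filterT.
by split; [exact: unitI_compact|exact: closedT].
Qed.

(** The exponential law: it holds for every [T] because the unit interval is locally compact and
    Hausdorff. *)
Lemma compact_open_uncurry {T Y : topologicalType}
    (f : T -> {compact-open, I -> Y}) :
  continuous f -> (forall t, continuous (f t : I -> Y)) ->
  continuous (fun ts : T * I => (f ts.1 : I -> Y) ts.2).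
Proof.
move=> cf cft.
have -> : (fun ts : T * I => (f ts.1 : I -> Y) ts.2) =
          uncurry (fun t => f t : I -> Y) by apply/funext => -[].
apply: continuous_uncurry => //; first exact: unitI_locally_compact.
exact: unitI_hausdorff.
Qed.

Lemma compact_open_curry {T Y : topologicalType} (F : T * I -> Y) :
  continuous F ->
  continuous ((fun t s => F (t, s)) : T -> {compact-open, I -> Y}).
Proof. exact: continuous_curry_fun. Qed.

End UnitIntervalTopology.

(** * Maps out of an arc-fan, and its contraction to the vertex *)

Section ArcFanTopology.
Variables (R : realType) (J : directedType).
Local Notation I := (unitI R).
Local Notation K := (dir_space J).

Definition fan_pt (u : K * I) : arc_fan R J := \pi_{eq_quot (cone_equiv R J)} u.

Lemma continuous_fan_pt : continuous fan_pt.
Proof. exact: (@pi_continuous _ {eq_quot (cone_equiv R J)}). Qed.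

Lemma fan_continuous (Z : topologicalType) (f : arc_fan R J -> Z) :
  continuous (fun u => f (fan_pt u)) -> continuous f.
Proof.
exact: (@quotient_continuous _ {eq_quot (cone_equiv R J)} Z f).2.
Qed.

Lemma fan_pt_zero (k l : K) : fan_pt (k, zero) = fan_pt (l, zero).
Proof. by apply/eqmodP; rewrite /= /cone_base !eqxx orbT. Qed.

(** The map induced on the cone when [f] is constant on [K * {zero}]; stated through
    representatives, so that it is total. *)
Definition fan_rect {Z : Type} (f : K * I -> Z) (u : arc_fan R J) : Z :=
  f (repr (u : {eq_quot (cone_equiv R J)})).

Lemma fan_rectE {Z : Type} (f : K * I -> Z) (z : Z) :
  (forall k, f (k, zero) = z) -> forall u, fan_rect f (fan_pt u) = f u.
Proof.
move=> fz u; rewrite /fan_rect.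
have : cone_equiv R J (repr (\pi_{eq_quot (cone_equiv R J)} u)) u.
  by apply/eqmodP; rewrite reprK.
rewrite -/(fan_pt u); move: (repr _) => /= v /predU1P[-> //|].
case: v u => [k s] [l t] /= /andP[/eqP-> /eqP->].
by rewrite !fz.
Qed.

Lemma fan_ind (P : arc_fan R J -> Prop) :
  (forall u, P (fan_pt u)) -> forall u, P u.
Proof.
by move=> Pu u; rewrite -[u](@reprK _ {eq_quot (cone_equiv R J)}); exact: Pu.
Qed.

End ArcFanTopology.

(** A contraction that keeps [c] fixed at all times, so that loops at [c] shrink relative to their
    endpoints. *)
Definition cone_contraction {R : realType} {Y : topologicalType} (c : Y)
    (C : Y * unitI R -> Y) : Prop :=
  [/\ continuous C, forall y, C (y, zero) = c, forall y, C (y, one) = y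
    & forall t, C (c, t) = c].

Lemma arc_fan_contractible (R : realType) (J : directedType) :
  exists (c : arc_fan R J) (C : arc_fan R J * unitI R -> arc_fan R J),
    cone_contraction c C /\ forall k, fan_pt (k, zero) = c.
Proof.
pose F (u : dir_space J * unitI R * unitI R) :=
  fan_pt (u.1.1, clampI (ival u.1.2 * ival u.2)).
have cF : continuous F.
  apply: continuous_compT (@continuous_fan_pt R J); apply: continuous_pairT.
    exact: continuous_compT (@continuous_fstT _ _) (@continuous_fstT _ _).
  apply: continuous_clampT; apply: continuous_mulT.
    apply: continuous_compT continuous_ival.
    exact: continuous_compT (@continuous_fstT _ _) (@continuous_sndT _ _).
  exact: continuous_compT (@continuous_sndT _ _) continuous_ival.
pose c : arc_fan R J := fan_pt (None, zero).
have F0 k t : F ((k, zero), t) = c.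
  by rewrite /F /= ival0 mul0r clampI_le0 //; exact: fan_pt_zero.
(* Scaling the arcs is descended to the quotient as a map into a function space, because the
   quotient topology tests maps on the fan itself and not on its product with the interval. *)
pose G : arc_fan R J -> {compact-open, unitI R -> arc_fan R J} :=
  fan_rect (fun u s => F (u, s)).
have GE u : G (fan_pt u) = (fun s => F (u, s)).
  by apply: (@fan_rectE _ _ _ _ (fun=> c)) => k; apply/funext => t; exact: F0.
have cG : continuous G.
  apply: fan_continuous; under [X in continuous X]eq_fun do rewrite GE.
  exact: compact_open_curry.
have cGu u : continuous (G u : unitI R -> arc_fan R J).
  by elim/fan_ind: u => u; rewrite GE; exact: continuous_slicer.
exists c, (fun ut => (G ut.1 : unitI R -> arc_fan R J) ut.2); split; last first.
  by move=> k; exact: fan_pt_zero.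
split; first exact: compact_open_uncurry.
- elim/fan_ind => -[k s] /=; rewrite GE /F /= ival0 mulr0 clampI_le0 //.
  exact: fan_pt_zero.
- by elim/fan_ind => -[k s] /=; rewrite GE /F /= ival1 mulr1 ivalK.
- by move=> t /=; rewrite /c GE F0.
Qed.

(** * The disk: radial contraction, and the square as a retract *)

Section UnitDisk.
Variable R : realType.
Local Notation I := (unitI R).
Local Notation D := (unit_disk R).

Lemma continuous_to_disk (T : topologicalType) (f : T -> D) :
  continuous (fun t => set_val (f t) : R * R) -> continuous f.
Proof. exact: (@continuous_comp_initial _ _ _ (set_val : D -> R * R) f). Qed.

Lemma continuous_disk_val : continuous (set_val : D -> R * R).
Proof. exact: initial_continuous. Qed.

Definition disk_pt (z : R * R) (zP : z.1 ^+ 2 + z.2 ^+ 2 <= 1) : D :=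
  exist (fun w => w \in _) z
    (mem_set (zP : [set w : R * R | w.1 ^+ 2 + w.2 ^+ 2 <= 1] z)).

Lemma disk_ptE (z : R * R) (zP : z.1 ^+ 2 + z.2 ^+ 2 <= 1) :
  set_val (disk_pt zP) = z.
Proof. by rewrite set_valE. Qed.

Lemma disk_val_inj : injective (set_val : D -> R * R).
Proof. by move=> u v; rewrite set_valE => /val_inj. Qed.

Lemma disk_center_subproof : (0 : R * R).1 ^+ 2 + (0 : R * R).2 ^+ 2 <= 1.
Proof. by rewrite /= expr0n /= addr0 ler01. Qed.

Definition disk_center : D := disk_pt disk_center_subproof.

Lemma unit_disk_contractible :
  exists C : D * I -> D, cone_contraction disk_center C.
Proof.
pose m (z : R * R) (t : I) : R * R := (ival t * z.1, ival t * z.2).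
have mP (z : D) t : 
    (m (set_val z) t).1 ^+ 2 + (m (set_val z) t).2 ^+ 2 <= 1.
  have : (set_val z : R * R).1 ^+ 2 + (set_val z : R * R).2 ^+ 2 <= 1.
    exact: (set_valP z).
  rewrite /m /=; move: (set_val z) => [x y] /= xy.
  have /andP[t0 t1] := ival_itv t; rewrite !exprMn -mulrDr.
  apply: le_trans xy; rewrite ler_piMl ?addr_ge0 ?sqr_ge0 //.
  by rewrite expr_le1.
pose C (zt : D * I) : D := disk_pt (mP zt.1 zt.2).
have CE zt : set_val (C zt) = m (set_val zt.1) zt.2 by rewrite disk_ptE.
exists C; split => [|z|z|t].
- apply: continuous_to_disk.
  under [X in continuous X]eq_fun do rewrite CE.
  have cv : continuous (fun zt : D * I => set_val zt.1 : R * R).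
    exact: continuous_compT (@continuous_fstT _ _) continuous_disk_val.
  have ct : continuous (fun zt : D * I => ival zt.2).
    exact: continuous_compT (@continuous_sndT _ _) continuous_ival.
  apply: continuous_pairT; apply: continuous_mulT ct _.
    exact: continuous_compT cv (@continuous_fstT _ _).
  exact: continuous_compT cv (@continuous_sndT _ _).
- by apply: disk_val_inj; rewrite CE disk_ptE /m /= ival0 !mul0r.
- by apply: disk_val_inj; rewrite CE /m /= ival1 !mul1r; case: (set_val z).
- by apply: disk_val_inj; rewrite CE /= !disk_ptE /m /= !mulr0.
Qed.

(** This transfers lifting from the disk to squares and intervals. The corner goes to the centre, so
    that the base point of the square is the point fixed by the contraction. *)
Lemma square_retract_of_disk : exists (i : I * I -> D) (r : D -> I * I),
  [/\ continuous i, continuous r, cancel i r & i (zero, zero) = disk_center].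
Proof.
(* Halving keeps the sum of the squares at most 1/2; doubling and clamping undoes it. *)
pose j (st : I * I) : R * R := (ival st.1 / 2, ival st.2 / 2).
have jP st : (j st).1 ^+ 2 + (j st).2 ^+ 2 <= 1.
  rewrite /j /=; have /andP[? ?] := ival_itv st.1.
  have /andP[? ?] := ival_itv st.2; rewrite !expr_div_n.
  have : ival st.1 ^+ 2 <= 1 by rewrite expr_le1.
  have : ival st.2 ^+ 2 <= 1 by rewrite expr_le1.
  by lra.
pose i st : D := disk_pt (jP st).
have iE st : set_val (i st) = j st by rewrite disk_ptE.
exists i, (fun z : D =>
  (clampI (2 * (set_val z).1), clampI (2 * (set_val z).2))).
split.
- apply: continuous_to_disk; under [X in continuous X]eq_fun do rewrite iE.
  have c1 := continuous_compT (@continuous_fstT I I) continuous_ival.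
  have c2 := continuous_compT (@continuous_sndT I I) continuous_ival.
  by apply: continuous_pairT; apply: continuous_mulT (@continuous_cstT _ _ _).
- have c1 := continuous_compT continuous_disk_val (@continuous_fstT R R).
  have c2 := continuous_compT continuous_disk_val (@continuous_sndT R R).
  by apply: continuous_pairT; apply: continuous_clampT;
    apply: continuous_mulT (@continuous_cstT _ _ _) _.
- move=> [s t]; rewrite iE /j /=.
  by rewrite ![2 * (_ / 2)]mulrC !divfK ?pnatr_eq0 // !ivalK.
- by apply: disk_val_inj; rewrite iE disk_ptE /j /= ival0 mul0r.
Qed.

End UnitDisk.

(** * Lifting maps whose source contracts to a point *)

Section ConicalFan.
Variable R : realType.
Local Notation I := (unitI R).

Lemma cone_path_connected (Y : topologicalType) (c : Y) (C : Y * I -> Y) :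
  cone_contraction c C -> path_connected R Y.
Proof.
move=> [cC C0 C1 Cc] x y.
have cCy z : continuous (fun s => C (z, s)) by exact: continuous_slicer.
pose q z : {path I from c to z} := mk_path (cCy z) (C0 z) (C1 z).
by split; exact: path_cat (path_rev (q x)) (q y).
Qed.

(** The contraction moves all points of the loop at once, and the endpoints stay at [c]. *)
Lemma cone_loop_trivial (Y : topologicalType) (c : Y) (C : Y * I -> Y)
    (a : {path I from c to c}) :
  cone_contraction c C -> path_homotopic a (path_cst c).
Proof.
move=> [cC C0 C1 Cc]; apply: path_homotopic_sym.
exists (fun st => C (a st.1, st.2)); split => [|s|s|t|t].
- apply: continuous_compT cC; apply: continuous_pairT;
    last exact: continuous_sndT.
  exact: continuous_compT (@continuous_fstT _ _) (@cts_fun _ _ a).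
- exact: C0.
- exact: C1.
- by rewrite path_zero.
- by rewrite path_one.
Qed.

Lemma fan_piece_contractible (o : option directedType) :
  exists (c : fan_piece R o) (C : fan_piece R o * I -> fan_piece R o),
    cone_contraction c C.
Proof.
case: o => [J|] /=; last first.
  by exists (disk_center R); exact: unit_disk_contractible.
by have [c [C [cC _]]] := arc_fan_contractible R J; exists c, C.
Qed.

Lemma fan_piece_in_Fan (o : option directedType) : in_Fan R (fan_piece R o).
Proof.
split; first by have [c [C /cone_path_connected]] := fan_piece_contractible o.
(* A piece is a quotient of the sum with itself as only summand. *)
exists unit, (fun=> o), (fun u => projT2 u); split.
  by rewrite -subTset => y _; exists (existT _ tt y).
move=> U; split => [oU|/sigT_openP/(_ tt)//].
by apply/sigT_openP.
Qed.

(** The condition on fundamental groups is automatic: every loop at [c] is trivial, so its image is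
    the unit. *)
Lemma cone_lift (Xh X Y : topologicalType) (p : continuousType Xh X)
    (c : Y) (C : Y * I -> Y) (f : Y -> X) (x : Xh) :
  Fan_covering R p -> in_Fan R Y -> cone_contraction c C ->
  continuous f -> f c = p x ->
  exists2 g : Y -> Xh, continuous g & g c = x /\ forall y, p (g y) = f y.
Proof.
move=> [_ plift] FY cC cf fc.
have [|g [[gc pg] _]] := plift Y x c (mkcts cf) fc FY.
  move=> v /pi1_imageP[u <-]; apply/pi1_imageP; exists 1%g; rewrite gmulf1.
  move: u; apply: pclass_ind => a.
  rewrite ((pclassP a (path_cst c)).2 (cone_loop_trivial a cC)).
  by rewrite -[pclass _]/(1%g : pi1 R c) gmulf1.
exists g; first exact: cts_fun.
by split=> // y; rewrite -[LHS]/((p \o g) y) pg.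
Qed.

(** Both maps lift [p \o h] with the same value at [c], and the covering allows only one such
    lift. *)
Lemma cone_lift_unique (Xh X Y : topologicalType) (p : continuousType Xh X)
    (c : Y) (C : Y * I -> Y) (g h : Y -> Xh) :
  Fan_covering R p -> in_Fan R Y -> cone_contraction c C ->
  continuous g -> continuous h -> g c = h c ->
  (forall y, p (g y) = p (h y)) -> g = h.
Proof.
move=> [_ plift] FY cC cg ch ghc pgh.
have cf := continuous_compT ch (@cts_fun _ _ p).
have [|k [_ kU]] := plift Y (h c) c (mkcts cf) erefl FY.
  move=> v /pi1_imageP[u <-]; apply/pi1_imageP; exists 1%g; rewrite gmulf1.
  move: u; apply: pclass_ind => a.
  rewrite ((pclassP a (path_cst c)).2 (cone_loop_trivial a cC)).
  by rewrite -[pclass _]/(1%g : pi1 R c) gmulf1.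
have kg : k = mkcts cg by apply: kU; split => //; apply/funext => y; exact: pgh.
have kh : k = mkcts ch by exact: kU.
exact: (congr1 (fun k : continuousType Y Xh => k : Y -> Xh)
  (etrans (esym kg) kh)).
Qed.

End ConicalFan.

(** * Lifts of paths and homotopies, and monodromy *)

Section PathLifting.
Context {R : realType} {Xh X : topologicalType} (p : continuousType Xh X).
Hypothesis pF : Fan_covering R p.
Local Notation I := (unitI R).

Let disk_in_Fan : in_Fan R (unit_disk R) := fan_piece_in_Fan R None.

Lemma square_lift (F : I * I -> X) (x : Xh) :
  continuous F -> F (zero, zero) = p x ->
  exists2 G : I * I -> Xh,
    continuous G & G (zero, zero) = x /\ forall st, p (G st) = F st.
Proof.
move=> cF F0; have [C cC] := unit_disk_contractible R.
have [i [r [ci cr ir i0]]] := square_retract_of_disk R.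
have [||G cG [Gx pG]] :=
    cone_lift (f := fun z => F (r z)) (x := x) pF disk_in_Fan cC.
- exact: continuous_compT cr cF.
- by rewrite -i0 ir.
exists (fun st => G (i st)); first exact: continuous_compT ci cG.
by rewrite i0; split=> // st; rewrite pG ir.
Qed.

Lemma path_lift (a : I -> X) (x : Xh) :
  continuous a -> a zero = p x ->
  exists2 b : I -> Xh, continuous b & b zero = x /\ forall s, p (b s) = a s.
Proof.
move=> ca a0; have [||G cG [G0 pG]] := @square_lift (fun st => a st.1) x.
- exact: continuous_compT (@continuous_fstT _ _) ca.
- exact: a0.
exists (fun s => G (s, zero)); last by split=> // s; rewrite pG.
exact: continuous_slicel.
Qed.

(** Pulled back along the first coordinate of the retraction, both paths become maps on the disk,
    where lifts are unique. *)
Lemma path_lift_unique (g h : I -> Xh) :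
  continuous g -> continuous h -> g zero = h zero ->
  (forall s, p (g s) = p (h s)) -> g = h.
Proof.
move=> cg ch gh0 pgh; have [C cC] := unit_disk_contractible R.
have [i [r [_ cr ir i0]]] := square_retract_of_disk R.
have cr1 := continuous_compT cr (@continuous_fstT I I).
have gh : (fun z => g (r z).1) = (fun z => h (r z).1).
  apply: (cone_lift_unique pF disk_in_Fan cC).
  - exact: continuous_compT cr1 cg.
  - exact: continuous_compT cr1 ch.
  - by rewrite -i0 ir.
  - by move=> z; exact: pgh.
by apply/funext => s; have := congr1 (@^~ (i (s, zero))) gh; rewrite /= ir.
Qed.

(** The lifted homotopy has [g] and [h] as its two horizontal sides, and its vertical sides are
    constant. *)
Lemma homotopic_lift_end (x y : X) (a b : {path I from x to y})
    (g h : I -> Xh) :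
  path_homotopic a b -> continuous g -> continuous h -> g zero = h zero ->
  (forall s, p (g s) = a s) -> (forall s, p (h s) = b s) -> g one = h one.
Proof.
move=> [F [cF Fa Fb F0 F1]] cg ch gh0 pg ph.
have [|G cG [G0 pG]] := @square_lift F (g zero) cF; first by rewrite Fa pg.
have cGs t : continuous (fun s => G (s, t)) by exact: continuous_slicel.
have cGt s : continuous (fun t => G (s, t)) by exact: continuous_slicer.
(* A vertical line lying over a single point is constant, by uniqueness of lifts. *)
have Gcst s x' : (forall t, F (s, t) = x') -> forall t, G (s, t) = G (s, zero).
  move=> Fs t; apply: (congr1 (@^~ t) (_ : (fun t => G (s, t)) = fun=> _)).
  apply: path_lift_unique => [|||u] //; first exact: continuous_cstT.
  by rewrite !pG !Fs.
have gE : g = (fun s => G (s, zero)).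
  by apply: path_lift_unique => // s; rewrite pg pG Fa.
have hE : h = (fun s => G (s, one)).
  apply: path_lift_unique => [|||s] //; last by rewrite ph pG Fb.
  by rewrite (Gcst _ _ F0) G0 gh0.
by rewrite gE hE (Gcst _ _ F1).
Qed.

Context {x0 : X} {xh : Xh} (pxh : p xh = x0).

Lemma plift_exists (a : path_space R x0) :
  exists b : {b : I -> Xh | continuous b},
    sval b zero = xh /\ forall s, p (sval b s) = psval a s.
Proof.
have [ca a0] := psvalP a; have [|b cb bP] := @path_lift (psval a) xh ca.
  by rewrite a0.
by exists (exist _ b cb).
Qed.

Definition plift (a : path_space R x0) : I -> Xh :=
  sval (sval (cid (plift_exists a))).

Lemma continuous_plift a : continuous (plift a).
Proof. exact: (svalP (sval (cid (plift_exists a)))). Qed.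

Lemma plift_zero a : plift a zero = xh.
Proof. exact: (svalP (cid (plift_exists a))).1. Qed.

Lemma pliftK a s : p (plift a s) = psval a s.
Proof. exact: (svalP (cid (plift_exists a))).2. Qed.

Lemma plift_unique (a : path_space R x0) (b : I -> Xh) :
  continuous b -> b zero = xh -> (forall s, p (b s) = psval a s) -> plift a = b.
Proof.
move=> cb b0 pb; apply: path_lift_unique => // [||s].
- exact: continuous_plift.
- by rewrite plift_zero b0.
- by rewrite pliftK pb.
Qed.

Definition plift_path (a : path_space R x0) (z : Xh) (e : plift a one = z) :
  {path I from xh to z} := mk_path (@continuous_plift a) (plift_zero a) e.

(** Hence the end of the lift is a complete invariant of the class modulo [H], which makes the map
    of the theorem well defined and injective. *)
Lemma path_mod_plift (a b : path_space R x0) :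
  path_mod (pi1_image (R := R) pxh) a b <-> plift a one = plift b one.
Proof.
split=> [/path_modP[y [ea [eb /pi1_imageP[u uE]]]]|e].
- move: u uE; apply: pclass_ind => d; rewrite pi1_mapE => dE.
  (* If the class of [a] times the inverse of that of [b] is the image of [d], then [a] is homotopic
     to the image of [d] followed by [b], whose lift is [d] followed by the lift of [b]. *)
  have : pclass (path_cat (Defs.path_map pxh pxh d) (path_to eb)) =
         pclass (path_to ea).
    by rewrite -pc_mulE dE -pc_mulA pc_mulVr pc_mulr1.
  move=> /pclassP hom; apply: esym.
  pose c : {path I from xh to plift b one} := path_cat d (plift_path (erefl _)).
  have <- : c one = plift b one by rewrite path_one.
  apply: (homotopic_lift_end hom).
  + exact: (@cts_fun _ _ c).
  + exact: continuous_plift.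
  + by rewrite path_zero plift_zero.
  + move=> s.
    rewrite -[LHS]/(p (cat_fun _ _ s)) -[RHS]/(cat_fun _ _ s) /cat_fun.
    by case: ifP => _ //; exact: pliftK.
  + exact: pliftK.
- have eab : psval a one = psval b one by rewrite -!pliftK e.
  apply/path_modP; exists (psval b one), eab, erefl; apply/pi1_imageP.
  (* The lift of [a] followed by the reverse of the lift of [b] is a loop at [xh]. *)
  exists (pclass (path_cat (plift_path e) (path_rev (plift_path erefl)))).
  rewrite pi1_mapE pc_invE pc_mulE; congr pclass; apply/path_eqP => s.
  rewrite -[LHS]/(p (cat_fun _ _ s)) -[RHS]/(cat_fun _ _ s) /cat_fun.
  by case: ifP => _; exact: pliftK.
Qed.

End PathLifting.

(** * Directed sets detect continuity *)

Section DirectedConvergence.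

Section DirSpaceTopology.
Variable J : directedType.
Local Notation K := (dir_space J).

Lemma open_dir_base (V : set K) : dir_base V -> open V.
Proof.
by move=> bV; exists [set V]; [move=> _ ->|rewrite bigcup_set1].
Qed.

Lemma open_dir_some (j : J) : open [set Some j : K].
Proof. by apply: open_dir_base; left; exists j. Qed.

Lemma open_dir_tail (k : J) : open (dir_tail k).
Proof. by apply: open_dir_base; right; exists k. Qed.

Lemma nbhs_dir_tail (V : set K) :
  nbhs (None : K) V -> exists k, dir_tail k `<=` V.
Proof.
rewrite nbhsE => -[_ [[B sB <-] [W BW WN]] BV].
case: (sB _ BW) => [[j _ WE]|[k _ WE]]; first by rewrite /= -WE in WN.
by exists k => u ku; apply: BV; exists W => //; rewrite /= -WE.
Qed.

End DirSpaceTopology.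

Variable T : topologicalType.

(* The second component makes the order have no maximal elements: otherwise,
   at a point with a smallest neighbourhood, the point at infinity would be
   isolated. *)
Definition nbhs_index (t : T) : Type := {A : set T | nbhs t A} * nat.

HB.instance Definition _ (t : T) := gen_eqMixin (nbhs_index t).
HB.instance Definition _ (t : T) := gen_choiceMixin (nbhs_index t).

Section NbhsIndex.
Variable t : T.

Definition nbhs_index_le (i j : nbhs_index t) : bool :=
  `[< sval j.1 `<=` sval i.1 >] && (i.2 <= j.2)%N.

Lemma nbhs_index_le_refl : reflexive nbhs_index_le.
Proof. by move=> i; rewrite /nbhs_index_le leqnn andbT; apply/asboolP. Qed.

Lemma nbhs_index_le_trans : transitive nbhs_index_le.
Proof.
move=> j i k /andP[/asboolP ij ij2] /andP[/asboolP jk jk2].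
apply/andP; split; last exact: leq_trans jk2.
by apply/asboolP; exact: subset_trans ij.
Qed.

HB.instance Definition _ := Order.Le_isPreorder.Build (Order.Disp tt tt)
  (nbhs_index t) nbhs_index_le_refl nbhs_index_le_trans.

Lemma nbhs_index_upper (i j : nbhs_index t) :
  exists2 k : nbhs_index t, (i <= k)%O & (j <= k)%O.
Proof.
case: i j => [[A tA] m] [[B tB] n].
exists (exist _ (A `&` B) (filterI tA tB), maxn m n); apply/andP; split=> /=.
- by apply/asboolP => ? [].
- exact: leq_maxl.
- by apply/asboolP => ? [].
- exact: leq_maxr.
Qed.

Lemma nbhs_index_inhabited : inhabited (nbhs_index t).
Proof. by split; exact: (exist _ [set: T] filterT, 0%N). Qed.

Definition nbhs_directed : directedType :=
  DirectedType nbhs_index_inhabited nbhs_index_upper.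

End NbhsIndex.

(** If [h] fails at [t] for [W], each neighbourhood of [t] has a point sent outside [W]. These
    points form a net converging to [t], a continuous map on a directed space whose image under [h]
    cannot converge. *)
Lemma directed_continuous (U : topologicalType) (h : T -> U) :
  (forall (J : directedType) (b : dir_space J -> T),
    continuous b -> continuous (fun k => h (b k))) ->
  continuous h.
Proof.
move=> hb t W tW; apply: contrapT => nW.
have /choice[w wP] : forall A : set T, exists s, nbhs t A -> A s /\ ~ W (h s).
  move=> A; case: (pselect (exists s, A s /\ ~ W (h s))) => [[s sP]|nA].
    by exists s.
  (* The value [t] is a default for sets that are not neighbourhoods; a neighbourhood without a bad
     point would contradict [nW]. *)
  exists t => tA; exfalso; apply: nW; apply: filterS tA => s As.
  by apply: contrapT => Ws; apply: nA; exists s.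
pose b (k : dir_space (nbhs_directed t)) : T :=
  if k is Some i then w (sval (i : nbhs_index t).1) else t.
have cb : continuous b.
  move=> [i|] V.
    move=> /nbhs_singleton Vi; apply: filterS (open_nbhs_nbhs _); last first.
      by split; [exact: open_dir_some|].
    by move=> _ ->.
  move=> tV; pose i : nbhs_index t := (exist _ V tV, 0%N).
  apply: filterS (open_nbhs_nbhs _); last first.
    by split; [exact: (open_dir_tail (J := nbhs_directed t) i)|left].
  move=> _ [->|[[[A tA] n] ij <-]]; first exact: nbhs_singleton tV.
  have /andP[/asboolP AV _] := Order.PreorderTheory.ltW ij.
  by apply: AV; exact: (wP A tA).1.
have [[[A tA] n] Wb] := nbhs_dir_tail (hb _ b cb None W tW).
(* Tails are strict, so the counter is raised to enter the tail of [(A, n)] with the same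
   neighbourhood. *)
pose j : nbhs_index t := (exist _ A tA, n.+1).
have : W (h (b (Some j))).
  apply: Wb; right; exists j => //=; rewrite Order.PreorderTheory.lt_leAnge.
  apply/andP; split.
    by apply/andP; split; [exact/asboolP|exact: leqnSn].
  by apply/negP => /andP[_]; rewrite /= ltnn.
exact: (wP A tA).2.
Qed.

End DirectedConvergence.

(** * Maps into and out of the path space *)

Section PathSpaceTopology.
Context {R : realType} {X : topologicalType} {x0 : X}.
Local Notation I := (unitI R).

Definition path_of (a : I -> X) (ca : continuous a) (a0 : a zero = x0) :
    path_space R x0 :=
  exist (fun b => b \in _) a (mem_set
    (conj ca a0 : [set b : {compact-open, I -> X} |
       continuous (b : I -> X) /\ (b : I -> X) zero = x0] a)).

Lemma psval_path_of (a : I -> X) (ca : continuous a) (a0 : a zero = x0) :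
  psval (path_of ca a0) = a.
Proof. by rewrite /psval set_valE. Qed.

Lemma continuous_psval :
  continuous (@psval R X x0 : path_space R x0 -> {compact-open, I -> X}).
Proof. exact: initial_continuous. Qed.

Lemma continuous_to_path_space (T : topologicalType)
    (m : T -> path_space R x0) :
  continuous (fun ts : T * I => psval (m ts.1) ts.2) -> continuous m.
Proof.
move=> /compact_open_curry cm.
exact: (@continuous_comp_initial _ _ _
  (set_val : path_space R x0 -> {compact-open, I -> X}) m).
Qed.

End PathSpaceTopology.

(** * Continuity of the bijection and of its inverse *)

Section LiftEnd.
Context {R : realType} {Xh X : topologicalType} (p : continuousType Xh X).
Hypothesis pF : Fan_covering R p.
Context {x0 : X} {xh : Xh} (pxh : p xh = x0).
Local Notation I := (unitI R).
Local Notation H := (pi1_image (R := R) pxh).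
Local Notation lift_end a := (plift pF pxh a one).

(** Path by path, lifting gives no control over nearby paths; a whole directed family is therefore
    lifted at once as a map on an arc-fan. *)
Lemma continuous_lift_end : continuous (fun a : path_space R x0 => lift_end a).
Proof.
apply: directed_continuous => J b cb.
pose f (ks : dir_space J * I) := psval (b ks.1) ks.2.
have cf : continuous f.
  apply: (@compact_open_uncurry _ _ _ (fun k => psval (b k))).
    exact: continuous_compT cb continuous_psval.
  by move=> k; exact: (psvalP (b k)).1.
have fE := @fan_rectE R J X f x0 (fun k => (psvalP (b k)).2).
have [c [C [cC cE]]] := arc_fan_contractible R J.
have [||g cg [gc pg]] :=
    cone_lift (f := fan_rect f) (x := xh) pF (fan_piece_in_Fan R (Some J)) cC.
- by apply: fan_continuous; under [X in continuous X]eq_fun do rewrite fE.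
- by rewrite -(cE None) fE pxh; exact: (psvalP (b None)).2.
have cgf := continuous_compT (@continuous_fan_pt R J) cg.
have cgs k : continuous (fun s => g (fan_pt (k, s))).
  exact: continuous_slicer cgf.
(* On the arc of index [k], [g] is a lift of [b k] starting at the vertex value [xh]. *)
have gE k : lift_end (b k) = g (fan_pt (k, one)).
  rewrite (@plift_unique _ _ _ _ pF _ _ pxh (b k) _ (cgs k)) ?cE // => s.
  by rewrite pg fE.
under [X in continuous X]eq_fun do rewrite gE.
exact: continuous_slicel cgf.
Qed.

Lemma lift_end_repr (a : path_space R x0) :
  lift_end (repr (\pi_(qtop_space H) a)) = lift_end a.
Proof.
apply/path_mod_plift; suff /asboolP : path_mod_equiv H
  (repr (\pi_(qtop_space H) a)) a by [].
by apply/eqmodP; rewrite reprK.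
Qed.

Lemma continuous_qtop_lift_end :
  continuous (fun u : qtop_space H => lift_end (repr u)).
Proof.
apply: (@quotient_continuous _ {eq_quot (path_mod_equiv H)} Xh _).2.
under [X in continuous X]eq_fun do rewrite /= lift_end_repr.
exact: continuous_lift_end.
Qed.

(** The contraction supplies a continuous choice of paths to the points of [Y], so [ph \o f] factors
    through the path space. *)
Lemma continuous_cone_qtop (Y : topologicalType) (c : Y) (C : Y * I -> Y)
    (f : Y -> Xh) (ph : Xh -> qtop_space H) :
  cone_contraction c C -> continuous f ->
  (forall a, ph (lift_end a) = \pi_(qtop_space H) a) ->
  continuous (fun y => ph (f y)).
Proof.
move=> [cC C0 C1 Cc] cf phE; have [a] := pF.1.1 xh (f c).
(* For each [y], a path from [xh] to [f y]: first [a] to [f c], then the image of the track of [y]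
   under the contraction. *)
pose g (ys : Y * I) : Xh := if ival ys.2 <= 2^-1 then a (clampI (2 * ival ys.2))
  else f (C (ys.1, clampI (2 * ival ys.2 - 1))).
have cs : continuous (fun ys : Y * I => ival ys.2).
  exact: continuous_compT (@continuous_sndT _ _) continuous_ival.
have c2s : continuous (fun ys : Y * I => 2 * ival ys.2).
  exact: continuous_mulT (@continuous_cstT _ _ _) cs.
have cg : continuous g.
  apply: (paste_continuous (h := fun ys : Y * I => ival ys.2)
    (f := fun ys => a (clampI (2 * ival ys.2)))
    (g := fun ys => f (C (ys.1, clampI (2 * ival ys.2 - 1))))).
  - exact: cs.
  - apply: (continuous_compT _ (@cts_fun _ _ a)).
    exact/continuous_clampT/c2s.
  - apply: (continuous_compT _ cf); apply: (continuous_compT _ cC).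
    apply: continuous_pairT; first exact: continuous_fstT.
    apply: continuous_clampT; apply: continuous_addT c2s _.
    exact: continuous_cstT.
  - move=> [y s] /= ->; rewrite divff ?subrr ?pnatr_eq0 //.
    by rewrite clampI_ge1 // clampI_le0 // path_one C0.
have cgs y : continuous (fun s => g (y, s)) by exact: continuous_slicer.
have g0 y : g (y, zero) = xh.
  by rewrite /g /= ival0 invr_ge0 ler0n mulr0 clampI_le0 // path_zero.
have g1 y : g (y, one) = f y.
  rewrite /g /= ival1 ifF; last by lra.
  by rewrite clampI_ge1 ?C1 //; lra.
have pg0 y : p (g (y, zero)) = x0 by rewrite g0.
pose m y := path_of (continuous_compT (cgs y) (@cts_fun _ _ p)) (pg0 y).
have mE y : psval (m y) = (fun s => p (g (y, s))) by exact: psval_path_of.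
have cm : continuous m.
  apply: continuous_to_path_space.
  under [X in continuous X]eq_fun do rewrite mE -surjective_pairing.
  exact: continuous_compT cg (@cts_fun _ _ p).
(* The path [g (y, _)] is itself the lift of its projection [m y]. *)
have fE y : f y = lift_end (m y).
  by rewrite (@plift_unique _ _ _ _ pF _ _ pxh (m y) _ (cgs y)) // => s;
    rewrite mE.
under [X in continuous X]eq_fun do rewrite fE phE.
exact: continuous_compT cm (@pi_continuous _ {eq_quot (path_mod_equiv H)}).
Qed.

End LiftEnd.

(** * Gluing over the pieces, and the homeomorphism *)

Lemma quotient_sum_continuous (A : choiceType) (P : A -> topologicalType)
    (Y Z : topologicalType) (q : {a : A & P a} -> Y) (h : Y -> Z) :
  quotient_map q ->
  (forall a (f : P a -> Y), continuous f -> continuous (fun x => h (f x))) ->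
  continuous h.
Proof.
move=> [_ qopen] hf; apply/continuousP => U oU.
have cq : continuous q by apply/continuousP => V oV; apply/qopen.
apply/qopen/sigT_openP => a.
have /hf/continuousP : continuous (fun x => q (existT P a x)).
  exact: continuous_compT (@existT_continuous _ _ a) cq.
exact.
Qed.

Theorem lemma71 (R : realType) (X : topologicalType) (x0 : X)
    (Xh : topologicalType) (p : continuousType Xh X) (xh : Xh)
    (pxh : p xh = x0) :
  path_connected R X -> Fan_covering R p ->
  exists ph : Xh -> qtop_space (pi1_image (R := R) pxh),
    homeomorphism ph /\ @endpoint R X x0 (pi1_image pxh) \o ph = p.
Proof.
move=> _ pF; pose e := fun a : path_space R x0 => plift pF pxh a one.
(* A path in [Xh] from [xh] to [z] is the lift of its own projection, so every point is the end of a
   lift. *)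
have /choice[m mE] : forall z, exists a, e a = z.
  move=> z; have [a] := pF.1.1 xh z.
  have pa0 : p (a zero) = x0 by rewrite path_zero.
  exists (path_of (continuous_compT (@cts_fun _ _ a) (@cts_fun _ _ p)) pa0).
  rewrite /e (@plift_unique _ _ _ _ pF _ _ pxh _ a) ?path_one ?path_zero //.
  exact: (@cts_fun _ _ a).
pose ph z := \pi_(qtop_space (pi1_image (R := R) pxh)) (m z).
(* The paths [m (e a)] and [a] have lifts with the same end, so the choice of [m] does not affect
   [ph]. *)
have phE a : ph (e a) = \pi_(qtop_space (pi1_image (R := R) pxh)) a.
  by apply/eqmodP/asboolP/path_mod_plift; exact: mE.
exists ph; split; last first.
  apply/funext => z; rewrite /= endpointE -(pliftK pF pxh).
  by rewrite -[plift _ _ _ _]/(e (m z)) mE.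
split.
  have [_ [A [po [q qq]]]] := pF.1.
  apply: (quotient_sum_continuous qq) => a f cf.
  have [c [C cC]] := fan_piece_contractible R (po a).
  exact: continuous_cone_qtop cC cf phE.
exists (fun u => e (repr u)); split.
- exact: continuous_qtop_lift_end.
- by move=> z; rewrite /e lift_end_repr; exact: mE.
- by move=> u; rewrite phE reprK.
Qed.
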